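(* Suppose that the nonempty matrix family $\mathscr A\subseteq\mathbb R^{n\times n}$ is uniformly exponentially stable and that $\mathcal W\subseteq\mathbb R^n$ is nonempty and bounded. Let $\mathcal X\subseteq\mathbb R^n$ and let $\{\mathcal X_k\}_{k\in\mathbb N}$ be the set-iteration sequence with $\mathcal X_0=\mathcal X$ defined in the context. Suppose that $\mathcal R\subseteq\operatorname{int}(\mathcal X)$ and that $\mathcal X_{\bar k}$ is bounded for some $\bar k\in\mathbb N$. Then the maximal robust positively invariant set $\mathcal M$ is nonempty and finitely determined (i.e. $\mathcal M=\mathcal X_k$ for some $k\in\mathbb N$). More precisely, there exists an integer $q\ge\bar k+1$ such that $\mathcal M=\mathcal X_{q-1}$.
   Context: $\mathbb N$ denotes the nonnegative integers; $\operatorname{int}$ and $\operatorname{cl}$ denote interior and closure. Put $\mathcal F(x):=\{Ax+w: A\in\mathscr A,\ w\in\mathcal W\}$. A set $\mathcal S\subseteq\mathbb R^n$ is robust positively invariant if for all $x\in\mathcal S$ one has $\mathcal F(x)\subseteq\mathcal S$ and $x\in\mathcal X$; the maximal robust positively invariant set $\mathcal M$ is the (existing, unique) robust positively invariant set containing every other one. The sequence $\{\mathcal X_k\}$ is given by $\mathcal X_0:=\mathcal X$ and $\mathcal X_{k+1}:=\{x\in\mathbb R^n:\mathcal F(x)\subseteq\mathcal X_k\}\cap\mathcal X$ (standard iteration). The same sequence is generated by the self-restricted iteration $\mathcal X_{k+1}=\{x\in\mathbb R^n:\mathcal F(x)\subseteq\mathcal X_k\}\cap\mathcal X_k$ and by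 the incremental iteration $\mathcal X_{k+1}=\mathcal X_k\cap\mathcal Y_{k+1}$, where, for $k\ge1$, $\mathcal Y_k$ is the set of $x_0\in\mathbb R^n$ such that $x_k\in\mathcal X$ for all $A_0,\dots,A_{k-1}\in\mathscr A$ and $w_0,\dots,w_{k-1}\in\mathcal W$, with $x_{j+1}=A_jx_j+w_j$. The family $\mathscr A$ is uniformly exponentially stable if there exist constants $c\ge1$ and $\rho\in[0,1)$ such that $\|A_{k-1}\cdots A_1A_0\|\le c\rho^k$ for every $k\ge1$ and every $A_0,\dots,A_{k-1}\in\mathscr A$, where $\|\cdot\|$ is a fixed matrix norm induced by a vector norm. For $k\ge1$, $\mathfrak B_k(\mathscr A)$ is the set of tuples $\boldsymbol\Psi_k=(\Psi_{k,0},\dots,\Psi_{k,k})$ generated by $A_0,\dots,A_{k-1}\in\mathscr A$ via $\Psi_{k,k}:=I$ and $\Psi_{k,i}:=A_{k-1}A_{k-2}\cdots A_i$ for $0\le i\le k-1$. The $k$-step disturbance-reachable set from the origin is $$\mathcal R_k:=\Big\{\sum_{i=0}^{k-1}\Psi_{k,i+1}w_i:\ \boldsymbol\Psi_k\in\mathfrak B_k(\mathscr A),\ w_0,\dots,w_{k-1}\in\mathcal W\Big\},$$ and $\mathcal R:=\bigcap_{\ell\ge1}\operatorname{cl}\big(\bigcup_{k\ge\ell}\mathcal R_k\big)$. *)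

(* Defs.v *)
From HB Require Import structures.
From mathcomp Require Import all_boot all_order all_algebra.
From mathcomp Require Import all_classical all_reals all_analysis.

Set Implicit Arguments.
Unset Strict Implicit.
Unset Printing Implicit Defensive.

Import Order.TTheory GRing.Theory Num.Theory.
Import numFieldNormedType.Exports.
Local Open Scope classical_set_scope.
Local Open Scope ring_scope.

Section Definitions.
Context {R : realType} {n : nat}.
Implicit Types (AA : set 'M[R]_n) (W X S M : set 'cV[R]_n).

Record vector_norm (N : 'cV[R]_n -> R) : Prop := VectorNorm {
  vector_normD : forall x y, N (x + y) <= N x + N y;
  vector_normZ : forall (a : R) x, N (a *: x) = `|a| * N x;
  vector_norm0_eq0 : forall x, N x = 0 -> x = 0 }.

(* The unit ball, rather than the unit sphere, keeps the set nonempty when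
   n = 0. For a vector norm N the set is bounded, so that this real-valued
   supremum is the genuine one. *)
Definition induced_norm (N : 'cV[R]_n -> R) (A : 'M[R]_n) : R :=
  sup [set N (A *m x) | x in [set x | N x <= 1]].

(* The factors appear with decreasing indices:
   A_(k-1) *m A_(k-2) *m ... *m A_i, and this is 1%:M when k <= i. *)
Definition backward_prod (A : nat -> 'M[R]_n) (k i : nat) : 'M[R]_n :=
  \big[mulmx/1%:M]_(j <- rev (index_iota i k)) A j.

Definition uniformly_exponentially_stable (N : 'cV[R]_n -> R) AA : Prop :=
  exists c rho : R, [/\ 1 <= c, 0 <= rho < 1 &
    forall (k : nat) (A : nat -> 'M[R]_n), (1 <= k)%N ->
      (forall j, (j < k)%N -> AA (A j)) ->
      induced_norm N (backward_prod A k 0) <= c * rho ^+ k].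

Definition succ_set AA W (x : 'cV[R]_n) : set 'cV[R]_n :=
  [set y | exists A w, [/\ AA A, W w & y = A *m x + w]].

Definition robust_positively_invariant AA W X S : Prop :=
  forall x, S x -> succ_set AA W x `<=` S /\ X x.

Definition maximal_rpi AA W X M : Prop :=
  robust_positively_invariant AA W X M /\
  forall S, robust_positively_invariant AA W X S -> S `<=` M.

Lemma maximal_rpi_exists AA W X : exists M, maximal_rpi AA W X M.
Proof.
exists [set x | exists2 S, robust_positively_invariant AA W X S & S x].
split=> [x [S rS Sx]|S rS x Sx]; last by exists S.
have [FS Xx] := rS x Sx.
by split=> // y /FS Sy; exists S.
Qed.

Lemma maximal_rpi_unique AA W X M M' :
  maximal_rpi AA W X M -> maximal_rpi AA W X M' -> M = M'.
Proof. by move=> [rM maxM] [rM' maxM']; apply/seteqP; split; auto. Qed.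

Fixpoint set_iteration AA W X (k : nat) : set 'cV[R]_n :=
  if k is k'.+1 then
    [set x | succ_set AA W x `<=` set_iteration AA W X k'] `&` X
  else X.

Definition finitely_determined AA W X M : Prop :=
  exists k, M = set_iteration AA W X k.

(* The tuples (Psi_(k,0), ..., Psi_(k,k)), as functions on 'I_k.+1. Only the
   first k terms of the sequence A matter. *)
Definition Psi_tuples AA (k : nat) : set ('I_k.+1 -> 'M[R]_n) :=
  [set Psi | exists2 A : nat -> 'M[R]_n,
     (forall j, (j < k)%N -> AA (A j)) &
     forall i : 'I_k.+1, Psi i = backward_prod A k i].

(* lift ord0 i : 'I_k.+1 is the index i + 1. *)
Definition reach_set AA W (k : nat) : set 'cV[R]_n :=
  [set x | exists (Psi : 'I_k.+1 -> 'M[R]_n) (w : 'I_k -> 'cV[R]_n),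
     [/\ Psi_tuples AA Psi, (forall i, W (w i)) &
         x = \sum_(i < k) Psi (lift ord0 i) *m w i]].

Definition limit_reach_set AA W : set 'cV[R]_n :=
  \bigcap_(l >= 1) closure (\bigcup_(k >= l) reach_set AA W k).

End Definitions.

(* Main.v *)
Require Import Defs.
From HB Require Import structures.
From mathcomp Require Import all_boot all_order all_algebra.
From mathcomp Require Import all_classical all_reals all_analysis.
From mathcomp Require Import ring zify.

Set Implicit Arguments.
Unset Strict Implicit.
Unset Printing Implicit Defensive.

Import Order.TTheory GRing.Theory Num.Theory.
Import numFieldNormedType.Exports.
Local Open Scope classical_set_scope.
Local Open Scope ring_scope.

(** The system [x_(j+1) = A_j x_j + w_j] forgets its initial state: the state
    reached after [k] steps is [Psi_(k,0) x_0 + r] with [r] in [R_k], and the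
    first term is at most [c rho^k |x_0|].

    Existence of a finite index.  The sets [R_k] are uniformly bounded (a
    geometric series, [reach_set_bounded]), so by Bolzano-Weierstrass any
    choice of points [r_l] in [R_(s l)] with [s l >= l] has a cluster point,
    and that point lies in the limit set (called [RR] below, and
    [limit_reach_set] in the code).  As [RR] is inside the interior of [X], a
    contradiction argument along such a sequence gives a uniform margin
    ([reach_set_margin]): for some [e > 0] and all large [k], every point at
    distance less than [e] from [R_k] is in [X].  A point of [X_k], with
    [k >= kbar], is in the bounded set [X_kbar], so for large [k] the term
    [Psi_(k+1,0) x_0] is smaller than [e], and the state at time [k+1] is in
    [X] automatically.  Since [X_k] consists of the points whose states stay in
    [X] up to time [k] ([set_iterationP]), this says that [X_k] is included in
    [X_(k+1)] ([set_iteration_stationary]).  Then [X_k] is robust positively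
    invariant; as every [X_k] contains every robust positively invariant set,
    it is the maximal one.

    Nonemptiness.  [RR] is nonempty by the same compactness argument, and it is
    itself robust positively invariant, because one step maps [R_k] into
    [R_(k+1)] and [x |-> A x + w] is continuous ([limit_reach_set_rpi]); hence
    it is included in the maximal set.

    Stability is stated for the norm induced by an arbitrary vector norm,
    whereas the topology is that of the entrywise maximum norm; the two are
    compared once, in [stable_uniform_decay], and the rest of the argument only
    uses the maximum norm. *)

(** * Metric preliminaries *)

Lemma mx_entry_le_norm (R : realType) (m n : nat) (x : 'M[R]_(m, n)) i j :
  `|x i j| <= `|x|.
Proof.
rewrite [leRHS]/Num.norm /= mx_normrE; apply/bigmax_geP; right => /=.
by exists (i, j).
Qed.

Lemma bounded_setP (R : realType) (V : normedModType R) (A : set V) :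
  bounded_set A -> exists2 C : R, 0 < C & forall x, A x -> `|x| <= C.
Proof. by move=> /pinfty_ex_gt0[C C0 AC]; exists C. Qed.

Lemma interior_normP (R : realType) (V : normedModType R) (A : set V) p :
  A° p -> exists2 e : R, 0 < e & forall y, `|p - y| < e -> A y.
Proof.
rewrite /interior => /nbhs_ballP[e /= e0 pA]; exists e => // y py.
by apply: pA; rewrite -ball_normE.
Qed.

Lemma closure_normP (R : realType) (V : normedModType R) (A : set V) p :
  closure A p <-> forall e : R, 0 < e -> exists2 y, A y & `|p - y| < e.
Proof.
split=> [Ap e e0|Ap B /nbhs_ballP[e /= e0 eB]].
  have [y [Ay py]] := Ap _ (nbhsx_ballx p e e0).
  by exists y => //; move: py; rewrite -ball_normE.
have [y Ay py] := Ap e e0.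
by exists y; split=> //; apply: eB; rewrite -ball_normE.
Qed.

(** Bolzano-Weierstrass, stated through cluster points so that no subsequence
    has to be extracted.  The compactness theorem used is the one for row
    vectors, hence the transpositions. *)
Lemma cV_bounded_seq_cluster (R : realType) (n : nat) (C : R)
    (u : nat -> 'cV[R]_n) :
  (forall k, `|u k| <= C) ->
  exists p, forall (e : R) (l : nat), 0 < e ->
    exists2 k, (l <= k)%N & `|p - u k| < e.
Proof.
move=> uC.
have cK : compact [set v : 'rV[R]_n | forall i, v ord0 i \in `[- C, C]].
  by apply: (@rV_compact _ _ (fun=> `[- C, C]%classic)) => _; exact: segment_compact.
have [|p [_ clp]] := cK ((fun k => (u k)^T) @ \oo) _.
  exists 0%N => // k _ i /=; rewrite mxE in_itv /= -ler_norml.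
  by rewrite (le_trans _ (uC k))// mx_entry_le_norm.
exists p^T => e l e0.
have [|_ [[k /= lk <-] [_ pu]]] := clp [set (u k)^T | k in [set k | l <= k]%N]
    _ _ (nbhsx_ballx p e e0).
  by exists l => // k lk; exists k.
exists k => //.
have : ball p^T e (u k) by split=> // i j; have := pu j i; rewrite !mxE.
by rewrite -ball_normE.
Qed.

(** * Equivalence of vector norms and the induced matrix norm *)

Section VectorNorms.
Context {R : realType} {n : nat}.
Implicit Types x y : 'cV[R]_n.

(** Expand [x] in the canonical basis.  Definiteness is not assumed, so that the
    bound also applies to functions such as [fun x => N (A *m x)] with [A]
    singular. *)
Lemma seminorm_le_norm (f : 'cV[R]_n -> R) :
  (forall x y, f (x + y) <= f x + f y) ->
  (forall (a : R) x, f (a *: x) = `|a| * f x) ->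
  exists2 b : R, 0 < b & forall x, f x <= b * `|x|.
Proof.
move=> fD fZ.
have f0 : f 0 = 0 by rewrite -(scale0r (0 : 'cV[R]_n)) fZ normr0 mul0r.
have fS (F : 'I_n -> 'cV[R]_n) : f (\sum_i F i) <= \sum_i f (F i).
  elim/big_rec2: _ => [|i s x _ xs]; first by rewrite f0.
  by apply: le_trans (fD _ _) _; rewrite lerD2l.
exists (1 + \sum_i `|f (delta_mx i 0)|).
  by rewrite ltr_pwDl// sumr_ge0.
move=> x; rewrite mulrDl mul1r ler_wpDl//.
have xE : x = \sum_i x i 0 *: delta_mx i 0.
  by rewrite {1}[x]matrix_sum_delta; apply: eq_bigr => i _; rewrite big_ord1.
rewrite {1}xE (le_trans (fS _))// mulr_suml; apply: ler_sum => i _.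
rewrite fZ mulrC (le_trans (ler_wpM2r _ (ler_norm _)))//.
by rewrite ler_wpM2l// mx_entry_le_norm.
Qed.

Context (N : 'cV[R]_n -> R) (normN : vector_norm N).

Lemma vector_norm0 : N 0 = 0.
Proof.
by rewrite -(scale0r (0 : 'cV[R]_n)) (vector_normZ normN) normr0 mul0r.
Qed.

Lemma vector_norm_ge0 x : 0 <= N x.
Proof.
have := vector_normD normN x (- x).
rewrite subrr vector_norm0 -scaleN1r (vector_normZ normN) normrN1 mul1r -mulr2n.
by rewrite pmulrn_lge0.
Qed.

Lemma vector_norm_le_norm : exists2 b : R, 0 < b & forall x, N x <= b * `|x|.
Proof.
exact: seminorm_le_norm (vector_normD normN) (vector_normZ normN).
Qed.

(** If no constant worked, there would be vectors [u k] on the unit sphere with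
    [N (u k) < 1 / (k + 1)]; a cluster point [p] satisfies [N p = 0] because [N]
    is Lipschitz, so [p = 0], although [p] is a limit of unit vectors. *)
Lemma norm_le_vector_norm : exists2 a : R, 0 < a & forall x, `|x| <= a * N x.
Proof.
have [b b0 Nb] := vector_norm_le_norm.
apply: contrapT => noa.
have /choice[u u1] : forall k : nat, exists v, `|v| = 1 /\ k.+1%:R * N v < 1.
  move=> k; apply: contrapT => nov; apply: noa; exists k.+1%:R => // x.
  rewrite leNgt; apply/negP => xN; apply: nov.
  have x0 : 0 < `|x|.
    by apply: le_lt_trans xN; rewrite mulr_ge0// vector_norm_ge0.
  exists (`|x|^-1 *: x); rewrite normrZ (vector_normZ normN) !normfV normr_id.
  rewrite mulVf ?gt_eqF//; split=> //.
  by rewrite mulrCA mulrC ltr_pdivrMr// mul1r.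
have [k|p clp] := @cV_bounded_seq_cluster _ _ 1 u.
  by rewrite (u1 k).1.
have Np : N p = 0.
  apply/eqP; rewrite eq_le vector_norm_ge0 andbT; apply/ler_addgt0Pl => e e0.
  have [l _ le] : exists2 l : nat, True & l.+1%:R^-1 < e / 2.
    have e2 : 0 < e / 2 by rewrite divr_gt0.
    have [l _ /(_ l (leqnn l))] := near_infty_natSinv_lt (PosNum e2).
    by exists l.
  have [k lk pu] := clp (e / 2 / b) l ltac:(by rewrite !divr_gt0).
  rewrite addr0 -[p](subrK (u k)) (le_trans (vector_normD normN _ _))//.
  rewrite [e]splitr lerD//.
    rewrite (le_trans (Nb _))// mulrC -ler_pdivlMr//; exact: ltW.
  apply/ltW/(lt_trans _ le)/(@lt_le_trans _ _ k.+1%:R^-1).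
    by rewrite -[ltRHS]mulr1 ltr_pdivlMl// (u1 k).2.
  by rewrite lef_pV2 ?posrE// ler_nat.
have p0 := vector_norm0_eq0 normN Np.
have [k _] := clp 1 0%N ltr01.
by rewrite p0 sub0r normrN (u1 k).1 ltxx.
Qed.

(** A supremum in [R] bounds its set only when that set is bounded above; this
    is where the equivalence of norms is needed. *)
Lemma induced_normP (A : 'M[R]_n) x : N (A *m x) <= induced_norm N A * N x.
Proof.
have [a a0 Na] := norm_le_vector_norm.
have [||b b0 fb] := @seminorm_le_norm (fun x => N (A *m x)).
- by move=> y z; rewrite mulmxDr (vector_normD normN).
- by move=> t y; rewrite -scalemxAr (vector_normZ normN).
have [x0|x0] := eqVneq (N x) 0.
  by rewrite x0 (vector_norm0_eq0 normN x0) mulmx0 vector_norm0 mulr0.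
have {}x0 : 0 < N x by rewrite lt_neqAle eq_sym x0 vector_norm_ge0.
have NV : `|(N x)^-1| = (N x)^-1 by rewrite gtr0_norm// invr_gt0.
rewrite -ler_pdivrMr// mulrC -{1}NV -(vector_normZ normN) scalemxAr.
apply: ub_le_sup; last first.
  exists ((N x)^-1 *: x) => //=.
  by rewrite (vector_normZ normN) NV mulVf// gt_eqF.
exists (b * a) => _ [v v1 <-]; rewrite (le_trans (fb v))// ler_pM2l//.
by rewrite (le_trans (Na v))// ger_pMr.
Qed.
End VectorNorms.

(** * Trajectories, reachable sets and the set iteration *)

Section Dynamics.
Context {R : realType} {n : nat}.
Implicit Types (A : nat -> 'M[R]_n) (w : nat -> 'cV[R]_n) (x : 'cV[R]_n).

Fixpoint trajectory A w x k :=
  if k is j.+1 then A j *m trajectory A w x j + w j else x.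

Lemma trajectorySl A w x k :
  trajectory A w x k.+1 =
  trajectory (A \o succn) (w \o succn) (A 0%N *m x + w 0%N) k.
Proof. by elim: k => //= k <-. Qed.

Lemma backward_prod_id A k : backward_prod A k k = 1%:M.
Proof. by rewrite /backward_prod /index_iota subnn big_nil. Qed.

Lemma backward_prodSl A k i : (i <= k)%N ->
  backward_prod A k.+1 i = A k *m backward_prod A k i.
Proof.
move=> ik; rewrite /backward_prod /index_iota subSn// -addn1 iotaD subnKC//=.
by rewrite rev_cat big_cons.
Qed.

Lemma eq_backward_prod A A' k i : (forall j, (j < k)%N -> A j = A' j) ->
  backward_prod A k i = backward_prod A' k i.
Proof.
move=> AA'; apply: eq_big_seq => j; rewrite mem_rev mem_index_iota.
by case/andP => _ /AA'.
Qed.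

Lemma trajectory_affine A w x k :
  trajectory A w x k = backward_prod A k 0 *m x + trajectory A w 0 k.
Proof.
elim: k => [|k IH] /=; first by rewrite backward_prod_id mul1mx addr0.
by rewrite IH backward_prodSl// mulmxDr mulmxA addrA.
Qed.

Lemma trajectory0E A w k :
  trajectory A w 0 k = \sum_(i < k) backward_prod A k i.+1 *m w i.
Proof.
elim: k => [|k IH] /=; first by rewrite big_ord0.
rewrite big_ord_recr /= backward_prod_id mul1mx IH mulmx_sumr; congr (_ + _).
by apply: eq_bigr => i _; rewrite backward_prodSl// mulmxA.
Qed.

(** Peeling off the first disturbance, rather than the last, only involves
    products down to index 0 (of a shifted sequence), which are the ones that
    the stability hypothesis bounds. *)
Lemma trajectory0Sl A w k :
  trajectory A w 0 k.+1 = backward_prod (A \o succn) k 0 *m w 0%N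
                          + trajectory (A \o succn) (w \o succn) 0 k.
Proof. by rewrite trajectorySl mulmx0 add0r trajectory_affine. Qed.

Context (AA : set 'M[R]_n) (W X : set 'cV[R]_n).
Context (AA0 : AA !=set0) (W0 : W !=set0).

(** Nonemptiness of both families lets finite sequences be extended arbitrarily,
    so that total sequences can be used throughout. *)
Lemma reach_setP k x : reach_set AA W k x <->
  exists A w, [/\ forall j, AA (A j), forall j, W (w j) &
                  x = trajectory A w 0 k].
Proof.
split=> [[Psi [w [[A AAA PsiE] Ww ->]]]|[A [w [AAA Ww ->]]]]; last first.
  exists (fun i => backward_prod A k i), (fun i => w i).
  split=> //; first by exists A.
  by rewrite trajectory0E; apply: eq_bigr => i _; rewrite lift0.
have [[A0 AAA0] [w0 Ww0]] := (AA0, W0).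
exists (fun j => if (j < k)%N then A j else A0), (fun j => oapp w w0 (insub j)).
split=> [j|j|]; first by case: ifP => // /AAA.
  by case: insub.
rewrite trajectory0E; apply: eq_bigr => i _; rewrite PsiE lift0 valK /=.
by congr (_ *m _); apply: eq_backward_prod => j ->.
Qed.

Lemma reach_set_succ k x (B : 'M[R]_n) (v : 'cV[R]_n) : AA B -> W v ->
  reach_set AA W k x -> reach_set AA W k.+1 (B *m x + v).
Proof.
move=> AAB Wv /reach_setP[A [w [AAA Ww ->]]]; apply/reach_setP.
exists (fun j => if j == k then B else A j),
  (fun j => if j == k then v else w j).
split=> [j|j|/=]; [by case: eqP|by case: eqP|rewrite eqxx; congr (_ *m _ + _)].
rewrite !trajectory0E; apply: eq_bigr => i _.
rewrite (@eq_backward_prod _ A) => [|j jk]; last by rewrite ltn_eqF.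
by rewrite ltn_eqF.
Qed.

(** The incremental description of the iteration: it constrains the states one
    time after another.  The recursion on [k] consumes the first step of the
    trajectory, whence the generalization over the initial state. *)
Lemma set_iterationP k x : set_iteration AA W X k x <->
  forall A w, (forall j, AA (A j)) -> (forall j, W (w j)) ->
  forall j, (j <= k)%N -> X (trajectory A w x j).
Proof.
elim: k x => [|k IH] x /=.
  split=> [Xx A w _ _ [|]//|Xt].
  have [[A0 AAA0] [w0 Ww0]] := (AA0, W0).
  exact: (Xt (fun=> A0) (fun=> w0) _ _ 0%N).
split=> [[Fx Xx] A w AAA Ww [//|j] jk|Xt].
  rewrite trajectorySl.
  have /Fx/IH : succ_set AA W x (A 0%N *m x + w 0%N) by exists (A 0%N), (w 0%N).
  by apply=> // i /=.
split; last first.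
  have [[A0 AAA0] [w0 Ww0]] := (AA0, W0).
  exact: (Xt (fun=> A0) (fun=> w0) _ _ 0%N).
move=> _ [A0 [w0 [AAA0 Ww0 ->]]]; apply/IH => A w AAA Ww j jk.
rewrite -(trajectorySl
  (fun i => if i is i'.+1 then A i' else A0)
  (fun i => if i is i'.+1 then w i' else w0)).
by apply: Xt => // [] [|i].
Qed.

Lemma rpi_sub_set_iteration S k :
  robust_positively_invariant AA W X S -> S `<=` set_iteration AA W X k.
Proof.
move=> rS; elim: k => [|k IH] x Sx /=; first by have [] := rS x Sx.
by have [FS Xx] := rS x Sx; split=> // y /FS /IH.
Qed.

Lemma set_iteration_rpi k :
  set_iteration AA W X k `<=` set_iteration AA W X k.+1 ->
  robust_positively_invariant AA W X (set_iteration AA W X k).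
Proof. by move=> XkS x /XkS. Qed.

Lemma limit_reach_setP p : limit_reach_set AA W p <->
  forall (e : R) (l : nat), 0 < e ->
  exists k r, [/\ (l <= k)%N, reach_set AA W k r & `|p - r| < e].
Proof.
split=> [Rp e l e0|Rp l _].
  have /closure_normP/(_ e e0)[r [k /= lk kr] pr] := Rp l.+1 (ltn0Sn l).
  by exists k, r; split=> //; exact: ltnW.
apply/closure_normP => e /(Rp e l)[k [r [lk kr pr]]].
by exists r => //; exists k.
Qed.

(** If [r] in [R_k] is close to [x], then [A r + w] is in [R_(k+1)] and close to
    [A x + w]. *)
Lemma limit_reach_set_rpi : limit_reach_set AA W `<=` X ->
  robust_positively_invariant AA W X (limit_reach_set AA W).
Proof.
move=> RX x Rx; split; last exact: RX.
move=> _ [A [w [AAA Ww ->]]]; apply/limit_reach_setP => e l e0.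
have [|t y|b b0 Ab] := @seminorm_le_norm R n (fun y => `|A *m y|).
- by move=> y z; rewrite mulmxDr ler_normD.
- by rewrite -scalemxAr normrZ.
have /limit_reach_setP/(_ (e / b) l (divr_gt0 e0 b0))[k [r [lk kr xr]]] := Rx.
exists k.+1, (A *m r + w); split; [exact: leqW|exact: reach_set_succ|].
rewrite opprD addrACA subrr addr0 -mulmxBr (le_lt_trans (Ab _))//.
by rewrite mulrC -ltr_pdivlMr.
Qed.

(** * Consequences of stability *)

(** Uniform exponential stability in the maximum norm, applied to vectors; the
    index [k = 0] is allowed. *)
Definition uniform_decay (c rho : R) := [/\ 0 < c, 0 <= rho < 1 &
  forall A k x, (forall j, AA (A j)) ->
    `|backward_prod A k 0 *m x| <= c * rho ^+ k * `|x|].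

Lemma stable_uniform_decay N : vector_norm N ->
  uniformly_exponentially_stable N AA -> exists c rho, uniform_decay c rho.
Proof.
move=> normN [c [rho [c1 rho01 AAc]]].
have [a a0 Na] := norm_le_vector_norm normN.
have [b b0 Nb] := vector_norm_le_norm normN.
have c0 : 0 < c by apply: lt_le_trans c1.
have rho0 : 0 <= rho by case/andP: rho01.
(* The summand 1 takes care of the empty product at k = 0. *)
exists (1 + a * c * b), rho; split=> // [|A [|k] x AAA].
- by rewrite addr_gt0// !mulr_gt0.
- by rewrite backward_prod_id mul1mx expr0 mulr1 ler_peMl// lerDl !mulr_ge0// ltW.
rewrite (le_trans (Na _))//.
apply: (@le_trans _ _ (a * ((c * rho ^+ k.+1) * (b * `|x|)))).
  rewrite ler_pM2l// (le_trans (induced_normP normN _ _))//.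
  apply: (@le_trans _ _ (c * rho ^+ k.+1 * N x)).
    by rewrite ler_wpM2r ?vector_norm_ge0// AAc.
  by rewrite ler_wpM2l// mulr_ge0 ?exprn_ge0// ltW.
have -> : a * (c * rho ^+ k.+1 * (b * `|x|)) = a * c * b * rho ^+ k.+1 * `|x|.
  ring.
by rewrite ler_wpM2r// ler_wpM2r ?exprn_ge0// lerDr.
Qed.

(** Each disturbance contributes at most [c rho^i D] when it has aged [i] steps;
    the sum of the first [k] such terms is [c D (1 - rho^k) / (1 - rho)]. *)
Lemma reach_set_bounded c rho : uniform_decay c rho -> bounded_set W ->
  exists C : R, forall k r, reach_set AA W k r -> `|r| <= C.
Proof.
move=> [c0 /andP[rho0 rho1] decay] /bounded_setP[D D0 WD].
exists (c * D / (1 - rho)) => k _ /reach_setP[A [w [AAA Ww ->]]].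
have rho'0 : 0 < 1 - rho by rewrite subr_gt0.
apply: (@le_trans _ _ (c * D * (1 - rho ^+ k) / (1 - rho))); last first.
  rewrite ler_pM2r ?invr_gt0// ler_piMr ?mulr_ge0 ?(ltW c0) ?(ltW D0)//.
  by rewrite gerBl exprn_ge0.
rewrite ler_pdivlMr//; elim: k A w AAA Ww => [|k IH] A w AAA Ww.
  by rewrite normr0 mul0r expr0 subrr mulr0.
rewrite trajectory0Sl (le_trans (ler_wpM2r (ltW rho'0) (ler_normD _ _)))//.
have -> : c * D * (1 - rho ^+ k.+1) =
    c * rho ^+ k * D * (1 - rho) + c * D * (1 - rho ^+ k).
  rewrite exprS; ring.
rewrite mulrDl lerD//; last by apply: IH => j /=.
rewrite ler_pM2r// (le_trans (decay _ _ _ _))//.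
  by move=> j /=.
by rewrite ler_wpM2l ?WD ?mulr_ge0 ?exprn_ge0 ?(ltW c0).
Qed.

Context {c rho : R} (decay : uniform_decay c rho) (bW : bounded_set W).

(** The compactness principle behind both the nonemptiness of the limit set and
    the uniform margin. *)
Lemma limit_reach_set_cluster (r : nat -> 'cV[R]_n) (s : nat -> nat) :
  (forall l, l <= s l)%N -> (forall l, reach_set AA W (s l) (r l)) ->
  exists2 p, limit_reach_set AA W p &
    forall (e : R) (l : nat), 0 < e -> exists2 m, (l <= m)%N & `|p - r m| < e.
Proof.
move=> ls sr; have [C RC] := reach_set_bounded decay bW.
have [l|p clp] := @cV_bounded_seq_cluster R n C r; first exact: RC (sr l).
exists p => //; apply/limit_reach_setP => e l /(clp e l)[m lm pm].
by exists (s m), (r m); split=> //; apply: leq_trans lm (ls m).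
Qed.

Lemma limit_reach_set_nonempty : limit_reach_set AA W !=set0.
Proof.
have [[A0 AAA0] [w0 Ww0]] := (AA0, W0).
have [||p Rp _] := @limit_reach_set_cluster
  (trajectory (fun=> A0) (fun=> w0) 0) id => //; last by exists p.
by move=> l; apply/reach_setP; exists (fun=> A0), (fun=> w0).
Qed.

(** Otherwise there are, for each [l], a reachable point [r_l] at some time at
    least [l] and a point outside [X] at distance less than [1 / (l + 1)] from
    it.  A cluster point of the [r_l] is in the limit set, hence interior to
    [X], yet it is also a limit of points outside [X]. *)
Lemma reach_set_margin : limit_reach_set AA W `<=` X° ->
  exists (l : nat) (e : R), 0 < e /\ forall k r y,
    (l <= k)%N -> reach_set AA W k r -> `|y - r| < e -> X y.
Proof.
move=> RX; apply: contrapT => nomargin.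
have /choice[f fP] : forall l : nat, exists t : nat * 'cV[R]_n * 'cV[R]_n,
    [/\ (l <= t.1.1)%N, reach_set AA W t.1.1 t.1.2,
        `|t.2 - t.1.2| < l.+1%:R^-1 & ~ X t.2].
  move=> l; apply: contrapT => not; apply: nomargin.
  exists l, l.+1%:R^-1; split=> // k r y lk kr yr.
  by apply: contrapT => nXy; apply: not; exists (k, r, y).
have [l|l|p Rp clp] := @limit_reach_set_cluster (fun l => (f l).1.2)
  (fun l => (f l).1.1).
- by have [] := fP l.
- by have [] := fP l.
have [e e0 eX] := interior_normP (RX p Rp).
have e2 : 0 < e / 2 by rewrite divr_gt0.
have [l _ /(_ l (leqnn l)) /= le] := near_infty_natSinv_lt (PosNum e2).
have [m lm pr] := clp _ l e2.
have [_ _ yr] := fP m; apply; apply: eX.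
rewrite -[p](subrK (f m).1.2) -addrA (le_lt_trans (ler_normD _ _))//.
rewrite [e]splitr ltrD// distrC (lt_trans _ le)// (lt_le_trans yr)//.
by rewrite lef_pV2 ?posrE// ler_nat.
Qed.

(** Only the state at time [k + 1] has to be checked.  It is a point of
    [R_(k+1)] moved by [Psi_(k+1,0) x], and [|x|] is bounded on [X_kbar], so for
    large [k] it is within the margin. *)
Lemma set_iteration_stationary (kbar : nat) :
  limit_reach_set AA W `<=` X° -> bounded_set (set_iteration AA W X kbar) ->
  exists2 k, (kbar <= k)%N &
    set_iteration AA W X k `<=` set_iteration AA W X k.+1.
Proof.
move=> RX /bounded_setP[C C0 XC].
have [l [e [e0 margin]]] := reach_set_margin RX.
have [c0 /andP[rho0 rho1] Adecay] := decay.
have [m _ mP] : \forall k \near \oo, rho ^+ k < e / (c * C).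
  have e'0 : 0 < e / (c * C) by rewrite divr_gt0// mulr_gt0.
  have rhoc : rho ^+ k @[k --> \oo] --> 0 by apply: cvg_expr; rewrite ger0_norm.
  exact: (cvgr_lt _ rhoc).
exists (kbar + l + m)%N; first by rewrite -addnA leq_addr.
set k := (kbar + l + m)%N.
move=> x /set_iterationP Xx; apply/set_iterationP => A w AAA Ww j.
rewrite leq_eqVlt => /predU1P[->|]; last exact: Xx.
apply: (margin k.+1 (trajectory A w 0 k.+1)).
- by rewrite /k; lia.
- by apply/reach_setP; exists A, w.
rewrite trajectory_affine addrK (le_lt_trans (Adecay _ _ _ AAA))//.
have xC : `|x| <= C.
  apply: XC; apply/set_iterationP => A' w' AAA' Ww' i ik.
  by apply: Xx => //; rewrite /k; lia.
have /= rhok : rho ^+ k.+1 < e / (c * C) by apply: mP; rewrite /= /k; lia.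
apply: (@le_lt_trans _ _ (c * rho ^+ k.+1 * C)).
  by rewrite ler_wpM2l// mulr_ge0 ?exprn_ge0// ltW.
by rewrite mulrAC mulrC -ltr_pdivlMr// mulr_gt0.
Qed.

End Dynamics.

Unset Implicit Arguments.

(** * The maximal robust positively invariant set *)

Theorem theorem5 (R : realType) (n : nat) (N : 'cV[R]_n -> R)
    (AA : set 'M[R]_n) (W X M : set 'cV[R]_n) (kbar : nat) :
  vector_norm N ->
  AA !=set0 -> uniformly_exponentially_stable N AA ->
  W !=set0 -> bounded_set W ->
  limit_reach_set AA W `<=` interior X ->
  bounded_set (set_iteration AA W X kbar) ->
  maximal_rpi AA W X M ->
  [/\ M !=set0, finitely_determined AA W X M &
      exists q : nat, (kbar + 1 <= q)%N /\ M = set_iteration AA W X (q - 1)].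
Proof.
move=> normN AA0 stable W0 bW RX bX [rM maxM].
have [c [rho decay]] := stable_uniform_decay normN stable.
have [k kbark Xk] := set_iteration_stationary AA0 W0 decay bW RX bX.
have ME : M = set_iteration AA W X k.
  apply/seteqP; split; first exact: rpi_sub_set_iteration.
  exact/maxM/set_iteration_rpi.
split; first 1 last.
- by exists k.
- by exists k.+1; rewrite addn1 ltnS subn1.
have [p Rp] := limit_reach_set_nonempty AA0 W0 decay bW.
exists p; apply: (maxM _ _ _ Rp); apply: limit_reach_set_rpi => // x /RX.
exact: interior_subset.
Qed.
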